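(* Let $G=(V=[n],E,(p_{uv})_{(u,v)\in E})$ be an influence graph and $k\in\{2,\dots,n\}$. Let $\pi^{GR}_k$ be the adaptive greedy policy: it selects $k$ seeds in $k$ steps and, at each step, having observed the partial realisation $\psi$ of the previously selected seeds, selects a node $v\in V\setminus dom(\psi)$ maximizing $\mathbb{E}_{\mathbf L}[\sigma_{\mathbf L}(\{v\}\cup dom(\psi))\mid\psi\subseteq\Phi]$. Then $$\sigma(\pi^{GR}_k)\ \ge\ \left(1-\left(1-\frac{1}{2k}\right)^k\right)OPT_A(G,k)\ \ge\ \left(1-\frac1{\sqrt e}\right)OPT_A(G,k).$$
   Context: Independent cascade model: $G$ is a directed graph on $V=[n]$ with activation probabilities $p_{uv}\in[0,1]$. The live-edge graph $\mathbf L\subseteq E$ contains each edge $(u,v)$ independently with probability $p_{uv}$. For $L\subseteq E$, $S\subseteq V$, $\sigma_L(S)$ is the number of nodes reachable (by a directed path of length $\ge0$ in $(V,L)$) from some node of $S$. Myopic feedback: the random realisation is $\Phi(v):=\{v\}\cup\{z:(v,z)\in\mathbf L\}$; a partial realisation $\psi$ is the restriction of $v\mapsto\{v\}\cup\{z:(v,z)\in L\}$ (for some $L\subseteq E$) to a set $dom(\psi)\subseteq V$, and $\psi\subseteq\Phi$ denotes the event that $\Phi(v)=\psi(v)$ for all $v\in dom(\psi)$. An adaptive policy $\pi$ maps partial realisations to a node or STOP; starting from $\psi=\emptyset$, while $\pi(\psi)=v\ne$ STOP it sets $\psi\leftarrow\psi\cup\{(v,\Phi(v))\}$, ending with $\Psi_\pi$;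 $\sigma(\pi):=\mathbb{E}[\sigma_{\mathbf L}(dom(\Psi_\pi))]$, and $|\pi|=k$ means $|dom(\Psi_\pi)|=k$ always. $OPT_A(G,k)$ is the maximum of $\sigma(\pi)$ over adaptive policies with $|\pi|=k$. *)

(* Defs.v *)
From HB Require Import structures.
From mathcomp Require Import all_boot all_order all_algebra.
From mathcomp Require Import classical_sets reals sequences exp.
Set Implicit Arguments. Unset Strict Implicit. Unset Printing Implicit Defensive.
Import Order.TTheory GRing.Theory Num.Theory.
Local Open Scope ring_scope.

Section IC.
Variable R : realType.
Variable n : nat.
Notation node := 'I_n.
Notation edgeset := {set (node * node)}.
Variable E : edgeset.
Variable p : node * node -> R.

Definition PrL (L : edgeset) : R :=
  if L \subset E then \prod_(e in E) (if e \in L then p e else 1 - p e) else 0.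

Definition reachset (L : edgeset) (S : {set node}) : {set node} :=
  [set v | [exists u in S, connect [rel x y | (x, y) \in L] u v]].
Definition sigmaL (L : edgeset) (S : {set node}) : nat := #|reachset L S|.

(* myopic feedback: Phi(v) = {v} U out-neighbours of v in L *)
Definition Phi (L : edgeset) (v : node) : {set node} :=
  v |: [set z | (v, z) \in L].

Definition preal := {ffun node -> option {set node}}.
Definition dom (psi : preal) : {set node} := [set v | psi v != None].
Definition empty_preal : preal := [ffun _ => None].
Definition consistent (psi : preal) (L : edgeset) : bool :=
  [forall v, if psi v is Some s then s == Phi L v else true].
Definition extend (psi : preal) (L : edgeset) (v : node) : preal :=
  [ffun x => if x == v then Some (Phi L v) else psi x].

(* adaptive policies: None encodes STOP *)
Definition policy := preal -> option node.
Definition step (pi : policy) (L : edgeset) (psi : preal) : preal :=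
  if pi psi is Some v then extend psi L v else psi.
Definition run (pi : policy) (L : edgeset) (j : nat) : preal :=
  iter j (step pi L) empty_preal.

(* |pi| = k: on every realisation the process stops with a domain of size k,
   i.e. it makes k steps each adding a new node and then stops *)
Definition policy_size (pi : policy) (k : nat) : Prop :=
  forall L : edgeset, L \subset E ->
    (forall j, (j < k)%N ->
       exists v, pi (run pi L j) = Some v /\ v \notin dom (run pi L j))
    /\ pi (run pi L k) = None.

(* sigma(pi) = E[sigma_L(dom Psi_pi)] for a policy of size k (Psi_pi = run k) *)
Definition sigma_pol (pi : policy) (k : nat) : R :=
  \sum_(L : edgeset) PrL L * (sigmaL L (dom (run pi L k)))%:R.

Definition OPT_A (k : nat) : R :=
  sup [set sigma_pol pi k | pi in [set pi : policy | policy_size pi k]].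

Definition Pr_cons (psi : preal) : R :=
  \sum_(L : edgeset) PrL L * (consistent psi L)%:R.
Definition cond_exp (psi : preal) (v : node) : R :=
  (\sum_(L : edgeset) PrL L * (consistent psi L)%:R
        * (sigmaL L (v |: dom psi))%:R) / Pr_cons psi.

Definition greedy_policy (pi : policy) (k : nat) : Prop :=
  forall psi : preal,
    ((#|dom psi| < k)%N ->
       exists v, pi psi = Some v /\ v \notin dom psi /\
         (0 < Pr_cons psi ->
            forall w, w \notin dom psi -> cond_exp psi w <= cond_exp psi v))
    /\ ((k <= #|dom psi|)%N -> pi psi = None).

End IC.

(* Main.v *)
(* Fix a node [w] and a function [y] of an auxiliary live-edge graph with values
   in [[0, 1]].  Run the optimal policy in a world [X]; let [f] be the mean of
   [y] when the out-edges of the nodes observed so far are resampled and all other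
   edges are taken from [X].  For a convex function [pot] with [pot 0 = 0], the
   expectation of [pot f], or of [max 0 (pot f - 1)] once [w] has been reached, is
   a potential: querying a node [v] lowers it by at least the probability that
   [w] is newly reached, up to [3/2] times the mean of [1 - y] on the event that
   [v] reaches [w] in an independent world.  Hence
     P(policy reaches w) <= E[pot y] + 3/2 * sum over picks v of E[1(v reaches w) (1 - y)].
   Take for [y] the weighted proportion of the times [i < k] at which the greedy
   seeds, run in the auxiliary world, already reach [w].  Summed over [w], the
   last term is at most [3/2 * k] times the weighted sum of the greedy increments,
   because in an independent world no fixed node beats the greedy choice, and the
   first term is also a combination of these increments.  It remains to choose
   weights for which every increment gets a coefficient at most
   [1 / (1 - (1 - 1/(2k))^k)]: an Euler scheme for [y' = (lam - pot y) / (3/2)]. *)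
Require Import Defs.
From HB Require Import structures.
From mathcomp Require Import all_boot all_order all_algebra.
From mathcomp Require Import reals.
From mathcomp Require Import ring lra.
Import Order.TTheory GRing.Theory Num.Theory.
Local Open Scope ring_scope.
Set Implicit Arguments. Unset Strict Implicit.

(** * The convex potential and the weights *)

Section ConvexPotential.
Variable R : realFieldType.
Implicit Types x y m lam : R.

Definition hinge x : R := Num.max 0 x.

(* The coefficients were found numerically.  What matters is convexity,
   [pot 0 = 0], [pot_step], and that [pot] is small enough for the Euler scheme
   of [schedule_large] to reach [1] in time. *)
Definition pot y : R :=
  y / 2 + 9 / 10 * y ^+ 2 + 7 / 5 * hinge (y - 3 / 10) ^+ 2 - 11 / 10 * hinge (y - 7 / 10) ^+ 2.

Definition pot' y : R :=
  1 / 2 + 9 / 5 * y + 14 / 5 * hinge (y - 3 / 10) - 11 / 5 * hinge (y - 7 / 10).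

Lemma hinge_cases a y : (y <= a /\ hinge (y - a) = 0) \/ (a <= y /\ hinge (y - a) = y - a).
Proof.
rewrite /hinge; case: (leP 0 (y - a)) => h; [right|left]; split => //; lra.
Qed.

Lemma hinge_le a y : y <= a -> hinge (y - a) = 0.
Proof. by move=> h; rewrite /hinge max_l // subr_le0. Qed.

Lemma hinge_gt a y : a <= y -> hinge (y - a) = y - a.
Proof. by move=> h; rewrite /hinge max_r // subr_ge0. Qed.

Ltac hinges := repeat (first [rewrite hinge_gt; last by [] | rewrite hinge_le; last by lra]).

Lemma zone y :
  [\/ [/\ y <= 3 / 10, y <= 7 / 10, hinge (y - 3 / 10) = 0 & hinge (y - 7 / 10) = 0],
      [/\ 3 / 10 <= y, y <= 7 / 10, hinge (y - 3 / 10) = y - 3 / 10 & hinge (y - 7 / 10) = 0] |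
      [/\ 3 / 10 <= y, 7 / 10 <= y, hinge (y - 3 / 10) = y - 3 / 10
         & hinge (y - 7 / 10) = y - 7 / 10]].
Proof.
case: (leP y (3 / 10)) => [h|/ltW h].
  by constructor 1; split; rewrite ?hinge_le //; lra.
case: (leP y (7 / 10)) => [h'|/ltW h'].
  by constructor 2; split; rewrite ?(hinge_gt h) ?(hinge_le h').
by constructor 3; split; rewrite ?(hinge_gt h) ?(hinge_gt h').
Qed.

(** Convexity in tangent form: the second derivative of [pot] is 9/5, 23/5 and 12/5 on its three
    pieces. *)
Lemma pot_subgrad x m : pot m + pot' m * (x - m) <= pot x.
Proof.
have q := sqr_ge0 (x - m); rewrite /pot /pot'.
have P (u v w z : R) : u <= v -> w <= z -> 0 <= (v - u) * (z - w).
  by move=> uv wz; rewrite mulr_ge0 // subr_ge0.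
case: (zone m) => -[ma mb -> ->]; case: (zone x) => -[xa xb -> ->].
- by lra.
- by have := sqr_ge0 (x - 3 / 10); lra.
- by have := sqr_ge0 (x - 3 / 10); lra.
- by have := sqr_ge0 (m - 3 / 10); have := P _ _ _ _ ma xa; lra.
- by lra.
- by have := sqr_ge0 (m - 7 / 10); have := P _ _ _ _ mb xb; lra.
- by have := sqr_ge0 (m - 3 / 10); have := P _ _ _ _ ma xa; lra.
- by have := sqr_ge0 (x - 7 / 10); lra.
- by lra.
Qed.

Lemma pot_lt1 m : 0 <= m -> pot m < 1 -> m < 7/10.
Proof.
rewrite /pot => m0; case: (zone m) => -[ma mb -> ->]; nra.
Qed.

Lemma pot_beta m x : 0 <= m -> m <= x -> x <= 1 -> pot m < 1 ->
  pot' m * (x - m) <= pot x - 1 + 3 / 2 * (1 - x).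
Proof.
move=> m0 mx x1 /(pot_lt1 m0) => m7; rewrite /pot /pot'.
case: (zone m) => -[ma mb -> ->]; case: (zone x) => -[xa xb -> ->]; try lra.
- by nra.
(* The first square is centred at the minimiser in [m] for fixed [x], the second near the minimiser
   in [x] of what remains. *)
- by have := sqr_ge0 (m - x / 2 + 5 / 36); have := sqr_ge0 (x - 113 / 200); lra.
- by nra.
- by nra.
- by have := sqr_ge0 (m - x / 2 - 17 / 460); have := sqr_ge0 (x - 363 / 500); lra.
- by have := sqr_ge0 (m - x / 2 - 17 / 460); have := sqr_ge0 (1 - x); lra.
Qed.

Definition pot1 x := hinge (pot x - 1).

Lemma hinge_ge0 x : 0 <= hinge x. Proof. by rewrite le_max lexx. Qed.

Lemma hinge_ge x : x <= hinge x. Proof. by rewrite le_max lexx orbT. Qed.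

Lemma pot1_subgrad m x :
  pot1 m + (if 0 <= pot m - 1 then pot' m else 0) * (x - m) <= pot1 x.
Proof.
rewrite /pot1 {1}/hinge; case: (leP 0 (pot m - 1)) => h.
  by have := pot_subgrad x m; have := hinge_ge (pot x - 1); lra.
by rewrite mul0r addr0 hinge_ge0.
Qed.

(** Used when the new seed hits [w], with [x] and [m] the means before and after the query. The
    [- 1] pays for the hit; this is where 3/2 comes from. *)
Lemma pot_step m x : 0 <= m <= 1 -> 0 <= x <= 1 ->
  pot1 m + pot' m * (x - m) <= pot x - 1 + 3 / 2 * (1 - x).
Proof.
move=> /andP[m0 m1] /andP[x0 x1].
have c := pot_subgrad x m.
rewrite /pot1 {1}/hinge; case: (leP 0 (pot m - 1)) => h.
  lra.
have pm : pot m < 1 by lra.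
case: (leP m x) => mx; first by have := pot_beta m0 mx x1 pm; lra.
have := pot_beta m0 (lexx m) m1 pm; rewrite subrr mulr0 => d; lra.
Qed.

Lemma pot_ge0 x : 0 <= x -> 0 <= pot x.
Proof.
rewrite /pot => x0.
case: (zone x) => -[xa xb -> ->]; nra.
Qed.

Lemma pot0 : pot 0 = 0.
Proof. by rewrite /pot /hinge !max_l ?expr0n ?mulr0 /= ?mul0r ?addr0 ?subr0 //; lra. Qed.

(* [crossT'] lies above the piecewise linear interpolation of the convex function
   [(3 / 2) / (5 / 2 - pot y)] at the nodes below, so [crossT y] bounds the time the
   flow [y' = (5 / 2 - pot y) / (3 / 2)] takes to reach [y]; that [crossT 1 < 1] is a
   numerical fact.  Convexity of [crossT] makes the Euler scheme at least as fast. *)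
Definition crossT y : R := 3 / 5 * y + (207 / 1000 * hinge (y - 0) ^+ 2
  + 293 / 1000 * hinge (y - 3 / 10) ^+ 2 + 745 / 1000 * hinge (y - 1 / 2) ^+ 2
  + 1305 / 1000 * hinge (y - 7 / 10) ^+ 2 + 222 / 100 * hinge (y - 4 / 5) ^+ 2
  + 385 / 100 * hinge (y - 9 / 10) ^+ 2 + 638 / 100 * hinge (y - 19 / 20) ^+ 2) / 2.

Definition crossT' y : R := 3 / 5 + 207 / 1000 * hinge (y - 0)
  + 293 / 1000 * hinge (y - 3 / 10) + 745 / 1000 * hinge (y - 1 / 2)
  + 1305 / 1000 * hinge (y - 7 / 10) + 222 / 100 * hinge (y - 4 / 5)
  + 385 / 100 * hinge (y - 9 / 10) + 638 / 100 * hinge (y - 19 / 20).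

Lemma hinge_sq_subgrad a x y :
  hinge (y - a) ^+ 2 + 2 * hinge (y - a) * (x - y) <= hinge (x - a) ^+ 2.
Proof.
have := sqr_ge0 (x - y).
case: (hinge_cases a y) => -[ya ->]; case: (hinge_cases a x) => -[xa ->]; nra.
Qed.

Lemma crossT_subgrad x y : crossT y + crossT' y * (x - y) <= crossT x.
Proof.
have s a := hinge_sq_subgrad a x y.
have := s 0; have := s (3/10); have := s (1/2); have := s (7/10).
have := s (4/5); have := s (9/10); have := s (19/20).
rewrite /crossT /crossT'; lra.
Qed.

Lemma crossT0 : crossT 0 = 0.
Proof. by rewrite /crossT !hinge_le; lra. Qed.

Lemma crossT1 : crossT 1 < 1.
Proof. by rewrite /crossT !hinge_gt; lra. Qed.

Lemma crossT'_ge0 y : 0 <= crossT' y.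
Proof. 
have h a := hinge_ge0 (y - a).
have := h 0; have := h (3/10); have := h (1/2); have := h (7/10).
have := h (4/5); have := h (9/10); have := h (19/20).
rewrite /crossT'; lra.
Qed.

Lemma crossT'_pot y : 0 <= y <= 1 -> 3 / 2 <= crossT' y * (5 / 2 - pot y).
Proof.
move=> /andP[y0 y1].
(* Between consecutive nodes [crossT'] is linear and [pot] quadratic, so the claim is a cubic
   inequality, certified by these products. *)
have P (a b : R) : a <= y -> y <= b ->
  [/\ 0 <= (y - a) * (b - y), 0 <= (y - a) * ((y - a) * (b - y)) & 0 <= (b - y) * ((y - a) * (b - y))].
  by move=> ay yb; split; rewrite ?mulr_ge0 ?subr_ge0.
rewrite /crossT' /pot.
case: (leP y (3/10)) => h1; first by have [] := P _ _ y0 h1; hinges; lra.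
move/ltW: h1 => h1.
case: (leP y (1/2)) => h2; first by have [] := P _ _ h1 h2; hinges; lra.
move/ltW: h2 => h2.
case: (leP y (7/10)) => h3; first by have [] := P _ _ h2 h3; hinges; lra.
move/ltW: h3 => h3.
case: (leP y (4/5)) => h4; first by have [] := P _ _ h3 h4; hinges; lra.
move/ltW: h4 => h4.
case: (leP y (9/10)) => h5; first by have [] := P _ _ h4 h5; hinges; lra.
move/ltW: h5 => h5.
case: (leP y (19/20)) => h6; first by have [] := P _ _ h5 h6; hinges; lra.
move/ltW: h6 => h6.
by have [] := P _ _ h6 y1; hinges; lra.
Qed.

(** * The approximation ratio and the weight schedules *)

Definition ratio k : R := (1 - (2 * k%:R)^-1) ^+ k.

(** [Z j] is the total weight of the last [j] greedy times; the inequality bounds by [lam] the final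
    coefficient of one greedy increment. *)
Definition schedule k lam (Z : nat -> R) :=
  [/\ Z 0%N = 0, Z k = 1 & forall j, (j < k)%N ->
    Z j <= Z j.+1 /\ 3 / 2 * k%:R * (Z j.+1 - Z j) + pot (Z j) <= lam].

(** The base for [k.+1] is that for [k] times [1 + d]. Bernoulli's bound on [(1 + d) ^+ k] outweighs
    the one extra factor. *)
Lemma ratio_mono k : (0 < k)%N -> ratio k <= ratio k.+1.
Proof.
move=> k0; rewrite /ratio.
have K1 : 1 <= k%:R :> R by rewrite ler1n.
set x : R := k%:R in K1 *.
have -> : k.+1%:R = x + 1 :> R by rewrite -addn1 natrD.
have u0 : 0 < 1 - (2 * x)^-1.
  by rewrite subr_gt0 invf_lt1; lra.
have e : 1 - (2 * (x + 1))^-1 = (1 - (2 * x)^-1) * (1 + ((x + 1) * (2 * x - 1))^-1).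
  by field; apply/and3P; split; lra.
rewrite exprSr {1}e exprMn.
set d := ((x + 1) * (2 * x - 1))^-1.
have dE : (x + 1) * (2 * x - 1) * d = 1.
  by rewrite /d divff // mulf_neq0 //; apply/negP => /eqP; lra.
have d0 : 0 <= d.
  by rewrite /d invr_ge0 mulr_ge0; lra.
have B : 1 + x * d <= (1 + d) ^+ k.
  rewrite /x; elim: (k) => [|j IH]; first by rewrite mul0r expr0 addr0.
  have j0 : 0 <= j%:R :> R by [].
  rewrite exprS -addn1 natrD; move: d0 IH j0 => {}; set w := (1 + d) ^+ j; nra.
have q0 : 0 <= (1 - (2 * x)^-1) ^+ k by rewrite exprn_ge0 // ltW.
have eq2 : (1 - (2 * x)^-1) * (1 + d) = 1 - (2 * (x + 1))^-1 by rewrite e.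
have v0 : 0 < (2 * (x + 1))^-1 by rewrite invr_gt0; lra.
have vE : (2 * (x + 1)) * (2 * (x + 1))^-1 = 1 by rewrite divff //; apply/negP => /eqP; lra.
have C : 1 <= (1 + x * d) * (1 - (2 * (x + 1))^-1).
  have -> : (1 + x * d) * (1 - (2 * (x + 1))^-1) = 1 + d / (2 * (x + 1)).
    by rewrite /d; field; rewrite -/x; apply/andP; split; apply/negP => /eqP; lra.
  by rewrite lerDl mulr_ge0 // ltW.
have D : 1 <= (1 + d) ^+ k * (1 - (2 * (x + 1))^-1).
  apply: le_trans C _; rewrite ler_wpM2r //; rewrite subr_ge0 invf_le1; lra.
by rewrite -mulrA -{1}[_ ^+ k]mulr1 ler_wpM2l.
Qed.

Lemma ratio_lt1 k : (0 < k)%N -> 0 <= ratio k < 1.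
Proof.
move=> k0; have K1 : 1 <= k%:R :> R by rewrite ler1n.
have a : 0 < (2 * k%:R)^-1 :> R by rewrite invr_gt0; lra.
have b : (2 * k%:R)^-1 < 1 :> R by rewrite invf_lt1; lra.
by rewrite /ratio exprn_ge0 ?exprn_ilt1 -?lt0n //; lra.
Qed.

Lemma le_ratioV k l : (0 < k)%N -> 0 < l -> 1 - l^-1 <= ratio k -> l <= (1 - ratio k)^-1.
Proof.
move=> k0 l0 h; case/andP: (ratio_lt1 k0) => h0 h1.
rewrite -[l]invrK lef_pV2 ?posrE ?invr_gt0 //; lra.
Qed.

(** 12 is the first [k] with [1 / (1 - ratio k)] at least 5/2, the constant of the flow. *)
Lemma ratio_ge12 k : (12 <= k)%N -> 3 / 5 <= ratio k.
Proof.
elim: k => // k IH; rewrite leq_eqVlt => /orP[/eqP <-|h].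
  rewrite /ratio; have -> : 1 - (2 * 12%:R)^-1 = 23 / 24 :> R by lra.
  lra.
by apply: le_trans (IH h) (ratio_mono _); apply: (@leq_trans 12).
Qed.

Lemma pot_le2 y : 0 <= y <= 1 -> pot y <= 2 :> R.
Proof.
move=> /andP[y0 y1]; rewrite /pot.
case: (zone y) => -[ya yb -> ->]; nra.
Qed.

Lemma schedule_large k : (12 <= k)%N -> exists Z, schedule k (1 - ratio k)^-1 Z.
Proof.
move=> k12; have k0 : (0 < k)%N by exact: leq_trans k12.
have lam : 5 / 2 <= (1 - ratio k)^-1.
  by apply: le_ratioV => //; have := ratio_ge12 k12; lra.
have K0 : 0 < k%:R :> R by rewrite ltr0n.
pose d (z : R) := (5 / 2 - pot z) / (3 / 2 * k%:R).
have dE z : 3 / 2 * k%:R * d z = 5 / 2 - pot z.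
  by rewrite /d; field; apply/negP => /eqP; lra.
pose Z j := iter j (fun z => Num.min 1 (z + d z)) 0.
have d_ge0 z : 0 <= z <= 1 -> 0 <= d z.
  by move=> /pot_le2 h; rewrite divr_ge0 ?mulr_ge0 //; lra.
have Z01 j : 0 <= Z j <= 1.
  elim: j => [|j IH]; first by rewrite /Z /= lexx ler01.
  rewrite /Z iterS -/(Z j) ge_min lexx andbT le_min ler01 /=.
  by have := d_ge0 _ IH; case/andP: IH; lra.
have Zmono j : Z j <= Z j.+1.
  rewrite {2}/Z iterS -/(Z j) le_min; have := d_ge0 _ (Z01 j).
  by case/andP: (Z01 j) => _ -> /=; rewrite lerDl.
(* By convexity each uncapped Euler step raises [crossT] by at least [1 / k]. After [k] steps it
   would be at least 1, above [crossT 1], so the cap 1 has been reached. *)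
have ZT j : Z j = 1 \/ j%:R / k%:R <= crossT (Z j).
  elim: j => [|j [IH|IH]]; first by right; rewrite /Z /= crossT0 mul0r.
    by left; have := Zmono j; case/andP: (Z01 j.+1); rewrite IH; lra.
  rewrite {1 2}/Z iterS -/(Z j); case: (leP 1 (Z j + d (Z j))) => h; first by left.
  right; have := crossT_subgrad (Z j + d (Z j)) (Z j).
  have -> : Z j + d (Z j) - Z j = d (Z j) by ring.
  have := crossT'_pot (Z01 j); rewrite -dE => c.
  have : k%:R^-1 <= crossT' (Z j) * d (Z j).
    have -> : crossT' (Z j) * d (Z j) = (crossT' (Z j) * (3 / 2 * k%:R * d (Z j))) / (3 / 2) / k%:R.
      by field; apply/negP => /eqP; lra.
    by rewrite ler_peMl ?invr_ge0 //; lra.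
  rewrite -addn1 natrD mulrDl mul1r; lra.
exists Z; split => //.
  case: (ZT k) => //; rewrite divff ?lt0r_neq0 // => h.
  case/andP: (Z01 k) => _; rewrite le_eqVlt => /orP[/eqP //|z1].
  have := crossT_subgrad 1 (Z k); have := crossT1.
  have : 0 <= crossT' (Z k) * (1 - Z k) by rewrite mulr_ge0 ?crossT'_ge0 ?subr_ge0 // ltW.
  lra.
move=> j jk; split; first exact: Zmono.
have : Z j.+1 <= Z j + d (Z j) by rewrite {1}/Z iterS ge_min lexx orbT.
rewrite -lerBlDl => h.
have : 3 / 2 * k%:R * (Z j.+1 - Z j) <= 3 / 2 * k%:R * d (Z j) by rewrite ler_pM2l //; lra.
rewrite dE; lra.
Qed.

(* Entry [k - 2], for [k = 2, ..., 11]: a lower bound of [1000 / (1 - ratio k)] and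
   the values [100 * Z j], [1 <= j <= k], of an Euler scheme rounded down. *)
Definition table : seq (nat * seq nat) :=
 [:: (2285, [:: 76; 100]); (2373, [:: 52; 92; 100]); (2416, [:: 40; 74; 95; 100]);
     (2441, [:: 32; 61; 83; 96; 100]); (2458, [:: 27; 52; 72; 87; 97; 100]);
     (2470, [:: 23; 44; 63; 78; 89; 97; 100]); (2479, [:: 20; 39; 56; 71; 82; 91; 97; 100]);
     (2486, [:: 18; 35; 51; 65; 76; 85; 92; 97; 100]);
     (2492, [:: 16; 31; 46; 59; 70; 79; 87; 93; 98; 100]);
     (2496, [:: 15; 29; 42; 54; 65; 74; 82; 88; 93; 97; 100])]%N.

(* The inequality of [schedule] times [10 ^ 5], with [Z j = u / 100] and
   [Z j.+1 = v / 100]; the truncated subtractions are the hinges of [pot]. *)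
Definition table_step k l (u v : nat) :=
  (u <= v)%N && (1500 * k * (v - u) + 500 * u + 9 * (u * u) + 14 * ((u - 30) * (u - 30))
    <= 100 * l + 11 * ((u - 70) * (u - 70)))%N.

Lemma table_ok k : (k < 10)%N ->
  let: (l, s) := nth (0, [::])%N table k in
  [&& (0 < l)%N, size s == k.+2, last 0%N s == 100%N & path (table_step k.+2 l) 0%N s].
Proof. by do 10 (case: k => [|k]; first by vm_compute). Qed.

Lemma table_ratio k : (k < 10)%N ->
  1 - ((nth (0, [::])%N table k).1%:R / 1000)^-1 <= ratio k.+2.
Proof.
by do 10 (case: k => [|k]; first by move=> _; rewrite /ratio /=; lra).
Qed.

Lemma schedule_small k : (2 <= k < 12)%N -> exists Z, schedule k (1 - ratio k)^-1 Z.
Proof.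
case: k => [|[|k]] // /andP[_ k10].
have := table_ok k10; have := table_ratio k10.
case: (nth _ _ _) => l s /= r /and4P[l0 /eqP sz /eqP ls /(pathP 0%N) st].
exists (fun j => (nth 0%N (0%N :: s) j)%:R / 100); split.
- by rewrite mul0r.
- by rewrite -sz -last_nth ls; lra.
move=> j jk; rewrite -sz in jk; have := st j jk.
rewrite /table_step /=; set u := nth _ (0 :: s)%N j; set v := nth _ s j.
case/andP=> uv h; split.
  have : u%:R <= v%:R :> R by rewrite ler_nat.
  lra.
have lam : l%:R / 1000 <= (1 - ratio k.+2)^-1.
  by apply: le_ratioV => //; rewrite divr_gt0 // ltr0n.
apply: le_trans lam.
have hg (a w : nat) : hinge (w%:R / 100 - a%:R / 100) = (w - a)%N%:R / 100 :> R.
  case: (leqP w a) => wa.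
    have wa' : w%:R <= a%:R :> R by rewrite ler_nat.
    by rewrite hinge_le; [rewrite (eqP wa) mul0r | lra].
  have aw := ltnW wa; have aw' : a%:R <= w%:R :> R by rewrite ler_nat.
  by rewrite hinge_gt; [rewrite natrB // mulrBl | lra].
have := hg 30%N u; have := hg 70%N u.
have -> : 30%:R / 100 = 3 / 10 :> R by lra.
have -> : 70%:R / 100 = 7 / 10 :> R by lra.
rewrite /pot => -> ->.
have cast (K a b c d e f x y : nat) :
    (a * K * (v - u) + b * u + c * (u * u) + d * (x * x) <= e * l + f * (y * y))%N ->
    a%:R * K%:R * (v%:R - u%:R) + b%:R * u%:R + c%:R * (u%:R * u%:R) + d%:R * (x%:R * x%:R)
      <= e%:R * l%:R + f%:R * (y%:R * y%:R) :> R.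
  by rewrite -(ler_nat R) !natrD !natrM (natrB _ uv).
move/cast: h; lra.
Qed.

End ConvexPotential.

(** * Live-edge graphs and runs of policies *)

Section Reach.
Variable n : nat.
Notation node := 'I_n.
Notation world := {set (node * node)}.
Implicit Types (X Y : world) (A D S T : {set node}).

Definition mix D X Y : world := [set e | if e.1 \in D then e \in X else e \in Y].

Definition del D X : world := [set e in X | e.1 \notin D].

Lemma in_mix D X Y e : (e \in mix D X Y) = if e.1 \in D then e \in X else e \in Y.
Proof. by rewrite inE. Qed.

Lemma reachP X S w :
  reflect (exists2 u, u \in S & connect [rel x y | (x, y) \in X] u w) (w \in reachset X S).
Proof. by rewrite inE; apply: (iffP exists_inP) => -[u]; exists u. Qed.

Lemma connect_subset X Y u w : X \subset Y ->
  connect [rel x y | (x, y) \in X] u w -> connect [rel x y | (x, y) \in Y] u w.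
Proof.
move/subsetP=> s; apply: connect_sub => a b /= ab; apply: connect1 => /=; exact: s.
Qed.

Lemma reachset_mono X Y S T : X \subset Y -> S \subset T -> reachset X S \subset reachset Y T.
Proof.
move=> XY /subsetP ST; apply/subsetP => w /reachP[u uS c].
by apply/reachP; exists u; [exact: ST | exact: connect_subset c].
Qed.

Lemma reachsetU X S T : reachset X (S :|: T) = reachset X S :|: reachset X T.
Proof.
apply/setP => w; rewrite in_setU; apply/reachP/orP.
  by move=> [u]; rewrite inE => /orP[uS|uS] c; [left|right]; apply/reachP; exists u.
by case=> /reachP[u uS c]; exists u => //; rewrite inE uS ?orbT.
Qed.

Lemma reachset0 X : reachset X set0 = set0.
Proof. by apply/setP => w; rewrite in_set0; apply/reachP => -[u]; rewrite in_set0. Qed.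

(* Cut a path from [A :|: D] at the last vertex of [A :|: D] on it. *)
Lemma reachset_split X A D w : [disjoint A & D] -> w \in reachset X (A :|: D) ->
  (w \in reachset (del D X) A) || (w \in reachset (del A X) D).
Proof.
move=> dis /reachP[u uAD /connectP[q]].
have sA : del (A :|: D) X \subset del D X.
  by apply/subsetP => e; rewrite !inE negb_or => /and3P[-> _ ->].
have sD : del (A :|: D) X \subset del A X.
  by apply/subsetP => e; rewrite !inE negb_or => /and3P[-> -> _].
have K x : connect [rel x y | (x, y) \in del (A :|: D) X] x w -> x \in A :|: D ->
  (w \in reachset (del D X) A) || (w \in reachset (del A X) D).
  move=> c; rewrite inE => /orP[xA|xD].
    by apply/orP; left; apply/reachP; exists x => //; exact: connect_subset c.
  by apply/orP; right; apply/reachP; exists x => //; exact: connect_subset c.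
move=> pq wq; suff [c|//] : connect [rel x y | (x, y) \in del (A :|: D) X] u w \/
    (w \in reachset (del D X) A) || (w \in reachset (del A X) D) by exact: K c uAD.
elim: q u {uAD} pq wq => [|x q IH] u /=; first by move=> _ ->; left.
case/andP=> ux pq wq; have [c|] := IH x pq wq; last by right.
case: (boolP (u \in A)) => uA.
  right; apply/orP; left; apply/reachP; exists u => //.
  apply: connect_trans (connect_subset sA c); apply: connect1 => /=.
  by rewrite inE ux /=; apply: contraTN uA => uD; rewrite (disjointFl dis).
case: (boolP (u \in D)) => uD.
  right; apply/orP; right; apply/reachP; exists u => //.
  by apply: connect_trans (connect_subset sD c); apply: connect1 => /=; rewrite inE ux.
left; apply: connect_trans c; apply: connect1 => /=.
by rewrite !inE ux /= negb_or uA uD.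
Qed.

Lemma del_sub D X : del D X \subset X.
Proof. by apply/subsetP => e; rewrite inE => /andP[]. Qed.

Lemma del_sub_mix D X Y : del D X \subset mix D Y X.
Proof. by apply/subsetP => e; rewrite !inE => /andP[-> /negbTE ->]. Qed.

Lemma del_mix D X Y : del D (mix D Y X) = del D X.
Proof. by apply/setP => e; rewrite !inE; case: (e.1 \in D); rewrite ?andbF. Qed.

Lemma mixK D X Y : mix D (mix D X Y) (mix D Y X) = X.
Proof. by apply/setP => e; rewrite !inE; case: (e.1 \in D). Qed.

Lemma mixC D X Y : mix (~: D) X Y = mix D Y X.
Proof. by apply/setP => e; rewrite !inE; case: (e.1 \in D). Qed.

Lemma mix0 X Y : mix set0 X Y = Y.
Proof. by apply/setP => e; rewrite !inE. Qed.

Lemma Phi_mix D X Y v : v \notin D -> Phi (mix D Y X) v = Phi X v.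
Proof. by move=> /negbTE vD; apply/setP => z; rewrite !inE /= vD. Qed.

Variable pi : policy n.

Definition seeds X j : {set node} := dom (run pi X j).

(** The new seed as a set, empty if the policy stops or repeats a node. *)
Definition seedsD X j := seeds X j.+1 :\: seeds X j.

Lemma seedsS X j : seeds X j.+1 =
  if pi (run pi X j) is Some v then v |: seeds X j else seeds X j.
Proof.
rewrite /seeds /run iterS -/(run pi X j) /step; case: (pi _) => [v|] //.
by apply/setP => x; rewrite !inE ffunE; case: (x == v).
Qed.

Lemma seeds0 X : seeds X 0 = set0.
Proof. by apply/setP => x; rewrite !inE ffunE. Qed.

Lemma seeds_sub X j : seeds X j \subset seeds X j.+1.
Proof. by rewrite seedsS; case: (pi _) => [v|] //; exact: subsetUr. Qed.

Lemma seedsU X j : seeds X j :|: seedsD X j = seeds X j.+1.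
Proof.
apply/setP => x; rewrite in_setU in_setD; case: (boolP (x \in seeds X j)) => //= xS.
by rewrite (subsetP (seeds_sub X j)).
Qed.

Lemma seedsD_disj X j : [disjoint seeds X j & seedsD X j].
Proof. by rewrite disjoint_sym disjoints_subset; exact: subsetDr. Qed.

Lemma seedsD_card X j : (#|seedsD X j| <= 1)%N.
Proof.
rewrite /seedsD seedsS; case: (pi _) => [v|]; last by rewrite setDv cards0.
rewrite -(cards1 v); apply: subset_leq_card; apply/subsetP => x.
by rewrite !inE => /andP[/negbTE ->]; rewrite orbF.
Qed.

Lemma consistent_run X j : consistent (run pi X j) X.
Proof.
elim: j => [|j IH]; first by apply/forallP => v; rewrite ffunE.
rewrite /run iterS -/(run pi X j) /step; case: (pi _) => [v|] //.
apply/forallP => x; rewrite ffunE; case: eqP => [->|_] //.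
exact: (forallP IH).
Qed.

(** A policy sees only its observations. Earlier stages are consistent with [Y] too, since all
    stages record values of [Phi X]. *)
Lemma run_consistent X Y j : consistent (run pi X j) Y -> run pi Y j = run pi X j.
Proof.
elim: j => // j IH h; rewrite /run !iterS -!/(run pi _ j) IH; last first.
  apply/forallP => v; case e: (run pi X j v) => [s|] //.
  have := consistent_run X j => /forallP/(_ v); rewrite e => /eqP ->.
  have := consistent_run X j.+1 => /forallP/(_ v); have := forallP h v.
  have : v \in seeds X j.+1 by apply: (subsetP (seeds_sub X j)); rewrite inE e.
  by rewrite inE; case: (run pi X j.+1 v) => // t _ /eqP -> /eqP ->.
move: h; rewrite /run iterS -/(run pi X j) /step; case: (pi _) => [v|] //.
by move/forallP/(_ v); rewrite ffunE eqxx => /eqP e; rewrite /extend e.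
Qed.

Lemma run_local X Y j : {in seeds X j, Phi X =1 Phi Y} -> run pi Y j = run pi X j.
Proof.
move=> h; apply: run_consistent; apply/forallP => v; case e: (run pi X j v) => [s|] //.
have := consistent_run X j => /forallP/(_ v); rewrite e => /eqP ->.
by apply/eqP/h; rewrite inE e.
Qed.

Lemma run_mix D X Y j : [disjoint seeds X j & D] -> run pi (mix D Y X) j = run pi X j.
Proof.
by move=> dis; apply: run_local => v vS; rewrite Phi_mix // (disjointFr dis vS).
Qed.

Lemma seeds_mix D X Y j : [disjoint seeds X j & D] -> seeds (mix D Y X) j = seeds X j.
Proof. by move=> dis; rewrite /seeds run_mix. Qed.

(** The next seed is chosen before its own out-edges are seen, so [D] may contain it. *)
Lemma seedsS_mix D X Y j : [disjoint seeds X j & D] ->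
  seeds (mix D Y X) j.+1 = seeds X j.+1.
Proof. by move=> dis; rewrite !seedsS run_mix // seeds_mix. Qed.

Lemma seedsD_mix D X Y j : [disjoint seeds X j & D] -> seedsD (mix D Y X) j = seedsD X j.
Proof. by move=> dis; rewrite /seedsD seedsS_mix // seeds_mix. Qed.
End Reach.

(** * Expectation over live-edge graphs and exchange of edges *)

Section Expectation.
Variables (R : realType) (n : nat) (E : {set ('I_n * 'I_n)}) (p : 'I_n * 'I_n -> R).
Hypothesis hp : forall e, e \in E -> 0 <= p e <= 1.
Notation node := 'I_n.
Notation world := {set (node * node)}.
Implicit Types (X Y : world) (A D S T : {set node}).

Definition Ex (f : world -> R) : R := \sum_X PrL E p X * f X.

(** Extending [p] by 0 outside [E] gives a product over all pairs, so edges of two worlds can be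
    exchanged one by one. *)
Lemma PrLE X : PrL E p X =
  \prod_e (if e \in X then (if e \in E then p e else 0) else 1 - (if e \in E then p e else 0)).
Proof.
rewrite /PrL; case: (boolP (X \subset E)) => [/subsetP XE|/subsetPn[e eX eE]].
  rewrite big_mkcond; apply: eq_bigr => e _.
  by case: (boolP (e \in E)) => eE //; rewrite subr0 (contraNF (XE e) eE).
by rewrite (bigD1 e) //= eX (negbTE eE) mul0r.
Qed.

Lemma PrL_ge0 X : 0 <= PrL E p X.
Proof.
rewrite PrLE prodr_ge0 // => e _; case: (boolP (e \in E)) => [/hp/andP[p0 p1]|_].
  by case: ifP => // _; rewrite subr_ge0.
by case: ifP; rewrite ?subr0 ?ler01.
Qed.

Lemma Ex1 : Ex (fun=> 1) = 1.
Proof.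
rewrite /Ex; under eq_bigr do rewrite mulr1 PrLE.
have := @bigA_distr R 0 1 *%R +%R (node * node)%type
  (fun e => if e \in E then p e else 0) (fun e => 1 - if e \in E then p e else 0).
rewrite [X in X = _]big1; last by move=> e _; rewrite /= addrC subrK.
by move=> e; rewrite [RHS]e; apply: eq_big => // X; rewrite inE.
Qed.

Lemma eq_Ex f g : f =1 g -> Ex f = Ex g.
Proof. by move=> fg; apply: eq_bigr => X _; rewrite fg. Qed.

Lemma le_Ex f g : (forall X, f X <= g X) -> Ex f <= Ex g.
Proof. by move=> fg; apply: ler_sum => X _; rewrite ler_wpM2l ?PrL_ge0. Qed.

Lemma ExD f g : Ex (fun X => f X + g X) = Ex f + Ex g.
Proof. by rewrite -big_split; apply: eq_bigr => X _; rewrite mulrDr. Qed.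

Lemma ExZ c f : Ex (fun X => c * f X) = c * Ex f.
Proof. by rewrite [RHS]mulr_sumr; apply: eq_bigr => X _; rewrite mulrCA. Qed.

Lemma ExB f g : Ex (fun X => f X - g X) = Ex f - Ex g.
Proof.
by rewrite -[- Ex g]mulN1r -ExZ -ExD; apply: eq_Ex => X; rewrite mulN1r.
Qed.

Lemma ExC c : Ex (fun=> c) = c.
Proof. by rewrite -[RHS]mulr1 -Ex1 -ExZ; apply: eq_Ex => X; rewrite mulr1. Qed.

Lemma Ex_sum (I : Type) (r : seq I) (P : pred I) (F : I -> world -> R) :
  Ex (fun X => \sum_(i <- r | P i) F i X) = \sum_(i <- r | P i) Ex (F i).
Proof.
by rewrite [RHS]exchange_big; apply: eq_bigr => X _; rewrite mulr_sumr.
Qed.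

Lemma Ex_ge0 f : (forall X, 0 <= f X) -> 0 <= Ex f.
Proof. by move=> f0; apply: sumr_ge0 => X _; rewrite mulr_ge0 ?PrL_ge0. Qed.

Lemma PrL_mix D X Y : PrL E p (mix D X Y) * PrL E p (mix D Y X) = PrL E p X * PrL E p Y.
Proof.
rewrite !PrLE -!big_split; apply: eq_bigr => e _ /=; rewrite !inE.
by case: (e.1 \in D) => //; rewrite mulrC.
Qed.

(* [D] may depend on [X], as long as the exchanged edges do not influence it. *)
Lemma Ex_swap (D : world -> {set node}) (g : world -> world -> R) :
  (forall X Y, D (mix (D X) Y X) = D X) ->
  Ex (fun X => Ex (g X)) = Ex (fun X => Ex (fun Y => g (mix (D X) Y X) (mix (D X) X Y))).
Proof.
move=> hD.
have toPair (f : world -> world -> R) :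
    Ex (fun X => Ex (f X)) = \sum_(u : world * world) PrL E p u.1 * PrL E p u.2 * f u.1 u.2.
  rewrite -(pair_bigA _ (fun X Y => PrL E p X * PrL E p Y * f X Y)) /=.
  by apply: eq_bigr => X _; rewrite mulr_sumr; apply: eq_bigr => Y _; rewrite mulrA.
rewrite !toPair; pose h (u : world * world) := (mix (D u.1) u.2 u.1, mix (D u.1) u.1 u.2).
have hK : involutive h by move=> [X Y]; rewrite /h /= hD !mixK.
rewrite (reindex_inj (inv_inj hK)); apply: eq_bigr => -[X Y] _ /=.
by rewrite PrL_mix [PrL E p Y * _]mulrC.
Qed.

End Expectation.

(** * The potential along a policy *)

Section Potential.
Variables (R : realType) (n : nat) (E : {set ('I_n * 'I_n)}) (p : 'I_n * 'I_n -> R).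
Hypothesis hp : forall e, e \in E -> 0 <= p e <= 1.
Notation node := 'I_n.
Notation world := {set (node * node)}.
Implicit Types (X Y : world) (A D S : {set node}).
Notation Ex := (Ex E p).

Variables (pi : policy n) (w : node) (y : world -> R).
Hypothesis y01 : forall X, 0 <= y X <= 1.

Definition resample j X : R := Ex (fun Y => y (mix (seeds pi X j) Y X)).

Definition hit j X : bool := w \in reachset X (seeds pi X j).

Definition potential j : R :=
  Ex (fun X => if hit j X then pot1 (resample j X) else pot (resample j X)).

Lemma resample01 j X : 0 <= resample j X <= 1.
Proof.
apply/andP; split; first by apply: Ex_ge0 => // Y; case/andP: (y01 (mix (seeds pi X j) Y X)).
by rewrite -(Ex1 E p); apply: le_Ex => // Y; case/andP: (y01 (mix (seeds pi X j) Y X)).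
Qed.

Definition cost j : R :=
  Ex (fun X => Ex (fun Y => (w \in reachset Y (seedsD pi X j))%:R * (1 - y Y))).

(** A fresh hit avoids the out-edges already observed; an old hit avoids those of the new seed,
    hence is unaffected by resampling them. *)
Definition fresh_hit j X : bool := w \in reachset (del (seeds pi X j) X) (seedsD pi X j).

Definition old_hit j X : bool := w \in reachset (del (seedsD pi X j) X) (seeds pi X j).

Lemma disj_setC (A : {set node}) : [disjoint A & ~: A].
Proof. by rewrite disjoints_subset setCK. Qed.

(** Exchange all unobserved edges: the independent world becomes [X] with its observed edges
    resampled. A fresh hit survives there, as it uses no observed edge. *)
Lemma cost_ge j : Ex (fun X => (fresh_hit j X)%:R * (1 - resample j X)) <= cost j.
Proof.
rewrite /cost (@Ex_swap _ _ _ _ (fun X => ~: seeds pi X j)); last first.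
  by move=> X Y; rewrite seeds_mix // disj_setC.
apply: le_Ex => // X.
have -> : 1 - resample j X = Ex (fun Y => 1 - y (mix (seeds pi X j) Y X)) by rewrite ExB ExC.
rewrite -ExZ; apply: le_Ex => // Y.
rewrite seedsD_mix ?disj_setC // mixC; apply: ler_wpM2r.
  by rewrite subr_ge0; case/andP: (y01 (mix (seeds pi X j) Y X)).
rewrite ler_nat; case: (boolP (fresh_hit j X)) => // h.
by rewrite (subsetP (reachset_mono (del_sub_mix _ _ _) (subxx _)) _ h).
Qed.

Definition slope j X : R :=
  if old_hit j X then (if 0 <= pot (resample j.+1 X) - 1 then pot' (resample j.+1 X) else 0)
  else pot' (resample j.+1 X).

(** Exchanging the new seed's out-edges between [X] and [Y] turns the world averaged in [resample j]
    into that of [resample j.+1] and fixes the slope. *)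
Lemma slope_mean j : Ex (fun X => slope j X * (resample j X - resample j.+1 X)) = 0.
Proof.
pose D X := seedsD pi X j.
have inv X Y : D (mix (D X) Y X) = D X by rewrite /D seedsD_mix // seedsD_disj.
have res X Y : resample j.+1 (mix (D X) Y X) = resample j.+1 X.
  apply: eq_Ex => Z; congr y; rewrite seedsS_mix ?seedsD_disj // -seedsU.
  apply/setP => e; rewrite !in_mix in_setU -/(D X); case: (e.1 \in seeds pi X j) => //=.
  by case: (e.1 \in D X).
have slo X Y : slope j (mix (D X) Y X) = slope j X.
  by rewrite /slope res /old_hit seedsD_mix ?seedsD_disj // seeds_mix ?seedsD_disj // del_mix.
have dE X : slope j X * (resample j X - resample j.+1 X)
    = Ex (fun Y => slope j X * y (mix (seeds pi X j) Y X))
      - Ex (fun Y => slope j X * y (mix (seeds pi X j.+1) Y X)).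
  by rewrite !ExZ mulrBr.
rewrite (eq_Ex _ _ dE) ExB (@Ex_swap _ _ _ _ D _ inv); apply/eqP; rewrite subr_eq0; apply/eqP.
apply: eq_Ex => X; apply: eq_Ex => Y; rewrite slo; congr (_ * y _).
rewrite seeds_mix ?seedsD_disj // -seedsU.
apply/setP => e; rewrite !in_mix in_setU -/(D X).
case: (boolP (e.1 \in seeds pi X j)) => //= eS.
by rewrite (disjointFr (seedsD_disj pi X j) eS).
Qed.

(* The slopes of the tangents of [pot] and [pot1] at [resample j.+1 X] depend only
   on edges that are not among the newly observed ones, so their contributions
   cancel in expectation by [slope_mean]. *)
Lemma potential_step j :
  Ex (fun X => (hit j.+1 X)%:R - (hit j X)%:R) + potential j.+1 <= potential j + 3 / 2 * cost j.
Proof.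
have c := cost_ge j; have s := slope_mean j.
suff h : Ex (fun X => (hit j.+1 X)%:R - (hit j X)%:R) + potential j.+1
    + Ex (fun X => slope j X * (resample j X - resample j.+1 X))
    <= potential j + 3 / 2 * Ex (fun X => (fresh_hit j X)%:R * (1 - resample j X)) by lra.
rewrite /potential -ExZ -!ExD; apply: le_Ex => // X.
have r0 := resample01 j X; have r1 := resample01 j.+1 X.
set f := resample j X in r0 *; set m := resample j.+1 X in r1 *.
have split : hit j.+1 X -> old_hit j X || fresh_hit j X.
  by rewrite /hit -seedsU; apply: reachset_split; exact: seedsD_disj.
have old : old_hit j X -> hit j X.
  by apply: (subsetP (reachset_mono (del_sub _ _) (subxx _))).
have new : fresh_hit j X -> hit j.+1 X.
  by apply: (subsetP (reachset_mono (del_sub _ _) _)); rewrite -seedsU subsetUr.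
have mono : hit j X -> hit j.+1 X.
  by apply: (subsetP (reachset_mono (subxx _) (seeds_sub _ _ _))).
have k1 := pot_step r1 r0; have k2 := pot_subgrad f m; have k3 := hinge_ge (pot f - 1).
have f1 : 0 <= 1 - f by rewrite subr_ge0; case/andP: r0.
(* An old hit needs only convexity of [pot1]. A fresh hit uses [pot_step], whether or not [w] was
   hit before. With neither, [w] is unhit at both times and convexity of [pot] suffices. *)
rewrite /slope -/m; case: (boolP (old_hit j X)) => o.
  rewrite (mono (old o)) (old o).
  have k4 : pot1 m + (if 0 <= pot m - 1 then pot' m else 0) * (f - m) <= pot1 f.
    exact: pot1_subgrad.
  have : 0 <= (fresh_hit j X)%:R * (1 - f) by rewrite mulr_ge0.
  lra.
case: (boolP (fresh_hit j X)) => fh.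
  by rewrite (new fh); case: (hit j X); rewrite /pot1 in k1 *; rewrite /=; lra.
case: (boolP (hit j.+1 X)) => h1; first by move: (split h1); rewrite (negbTE o) (negbTE fh).
by rewrite (negbTE (contra mono h1)); rewrite /=; lra.
Qed.

Lemma potential0 : potential 0 = Ex (fun X => pot (y X)).
Proof.
apply: eq_Ex => X; rewrite /hit /resample seeds0 reachset0 inE.
by congr pot; rewrite -[RHS](ExC E p); apply: eq_Ex => Y; rewrite mix0.
Qed.

Lemma potential_ge0 j : 0 <= potential j.
Proof.
apply: Ex_ge0 => // X; case: ifP => _; first exact: hinge_ge0.
by apply: pot_ge0; case/andP: (resample01 j X).
Qed.

Lemma hit_le k : Ex (fun X => (hit k X)%:R) <= Ex (fun X => pot (y X)) + 3 / 2 * \sum_(j < k) cost j.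
Proof.
suff h : Ex (fun X => (hit k X)%:R) + potential k
    <= Ex (fun X => pot (y X)) + 3 / 2 * \sum_(j < k) cost j.
  by have := potential_ge0 k; lra.
elim: k => [|k IH].
  rewrite big_ord0 mulr0 addr0 potential0 -[leRHS]add0r lerD2r -(ExC E p 0).
  by apply: le_Ex => // X; rewrite /hit seeds0 reachset0 inE.
have := potential_step k; rewrite ExB big_ord_recr /=; lra.
Qed.
End Potential.

(** * Greedy *)

Section Greedy.
Variables (R : realType) (n : nat) (E : {set ('I_n * 'I_n)}) (p : 'I_n * 'I_n -> R).
Hypothesis hp : forall e, e \in E -> 0 <= p e <= 1.
Notation node := 'I_n.
Notation world := {set (node * node)}.
Implicit Types (X Y : world) (A D S : {set node}).
Notation Ex := (Ex E p).
Variables (k : nat) (gr : policy n).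
Hypothesis gr_greedy : greedy_policy E p gr k.

Lemma greedy_pick X j : #|seeds gr X j| = j -> (j < k)%N ->
  exists v, gr (run gr X j) = Some v /\ v \notin seeds gr X j.
Proof.
move=> c jk; have [g _] := gr_greedy (run gr X j).
by have [|v [e [vn _]]] := g; [rewrite -/(seeds gr X j) c | exists v].
Qed.

Lemma card_greedy X j : (j <= k)%N -> #|seeds gr X j| = j.
Proof.
elim: j => [|j IH] jk; first by rewrite seeds0 cards0.
have c := IH (ltnW jk); have [v [e vn]] := greedy_pick c jk.
by rewrite seedsS e cardsU1 vn c.
Qed.

Lemma greedy_policy_size : policy_size E gr k.
Proof.
move=> X _; split=> [j jk|]; first exact: greedy_pick (card_greedy X (ltnW jk)) jk.
by have [_ ->] := gr_greedy (run gr X k); rewrite // -/(seeds gr X k) card_greedy.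
Qed.

Definition spread j : R := Ex (fun X => #|reachset X (seeds gr X j)|%:R).

(** Split the worlds by the greedy partial realisation. On each cell the greedy choice is
    conditionally optimal, hence beats a node fixed in advance. *)
Lemma greedy_best j D : (j < k)%N -> (#|D| <= 1)%N ->
  Ex (fun X => #|reachset X (D :|: seeds gr X j)|%:R) <= spread j.+1.
Proof.
move=> jk D1; rewrite /spread /Ex.
rewrite (partition_big (fun X => run gr X j) xpredT) //=.
rewrite [leRHS](partition_big (fun X => run gr X j) xpredT) //=.
apply: ler_sum => psi _.
have [X0 /eqP runX0|none] := pickP (fun X => run gr X j == psi); last first.
  by rewrite !big_pred0.
have consE X : (run gr X j == psi) = consistent psi X.
  apply/eqP/idP => [<-|]; first exact: consistent_run.
  by rewrite -runX0; apply: run_consistent.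
have dpsi : #|dom psi| = j by rewrite -runX0 -/(seeds gr X0 j) card_greedy // ltnW.
have [g _] := gr_greedy psi; have [|v [gv [vn best]]] := g; first by rewrite dpsi.
have restrict (f h : world -> R) : (forall X, run gr X j = psi -> f X = h X) ->
    \sum_(X | run gr X j == psi) PrL E p X * f X
    = \sum_X PrL E p X * (consistent psi X)%:R * h X.
  move=> fh; rewrite big_mkcond; apply: eq_bigr => X _; rewrite -consE.
  by case: eqP => [/fh ->|_]; rewrite ?mulr1 // mulr0 mul0r.
rewrite (restrict _ (fun X => #|reachset X (D :|: dom psi)|%:R)); last by move=> X <-.
rewrite (restrict _ (fun X => #|reachset X (v |: dom psi)|%:R)); last first.
  by move=> X runX; rewrite seedsS runX gv /seeds runX.
have P0 X : 0 <= PrL E p X * (consistent psi X)%:R by rewrite mulr_ge0 ?PrL_ge0.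
have [sub|nsub] := boolP (D \subset dom psi).
  apply: ler_sum => X _; rewrite ler_wpM2l // ler_nat subset_leq_card // reachset_mono //.
  by rewrite (setUidPr sub) subsetUr.
have [u uD un] := subsetPn nsub.
have -> : D = [set u].
  by apply/esym/eqP; rewrite eqEcard cards1 D1 sub1set uD.
have: 0 <= Pr_cons E p psi by apply: sumr_ge0 => X _; exact: P0.
(* Greediness constrains only partial realisations of positive probability; on the others every term
   is 0. *)
rewrite le_eqVlt => /orP[/eqP/esym/eqP|pos].
  rewrite psumr_eq0 // => /allP z.
  by rewrite !big1 // => X _; rewrite (eqP (z X (mem_index_enum X))) mul0r.
by have := best pos u un; rewrite /cond_exp ler_pM2r ?invr_gt0.
Qed.

Lemma spread_mono j : (j < k)%N -> spread j <= spread j.+1.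
Proof.
move=> jk; apply: le_trans (@greedy_best j set0 jk _); last by rewrite cards0.
by apply: le_Ex => // X; rewrite set0U.
Qed.

Lemma spread0 : spread 0 = 0.
Proof. by rewrite -[RHS](ExC E p); apply: eq_Ex => X; rewrite seeds0 reachset0 cards0. Qed.

Lemma card_sumE (S : {set node}) : #|S|%:R = \sum_w (w \in S)%:R :> R.
Proof. by rewrite -sum1_card natr_sum big_mkcond; apply: eq_bigr => w _; case: (w \in S). Qed.

(** In each world the nodes reached from [D] but not from the greedy seeds are exactly the gain from
    adding [D]. *)
Lemma gain_le j D : (j < k)%N -> (#|D| <= 1)%N ->
  \sum_w Ex (fun Y => (w \in reachset Y D)%:R * (1 - (w \in reachset Y (seeds gr Y j))%:R))
    <= spread j.+1 - spread j.
Proof.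
move=> jk D1; rewrite lerBrDr; apply: le_trans (greedy_best jk D1).
rewrite -Ex_sum -ExD; apply: le_Ex => // Y.
rewrite !card_sumE -big_split; apply: ler_sum => w _ /=.
rewrite reachsetU in_setU; do 2 case: (w \in _); rewrite /=; lra.
Qed.

(* Abel summation along the first index at which [u] becomes true. *)
Lemma first_time_sum (u : nat -> bool) (f : R -> R) (Z : nat -> R) m :
  (forall i, u i -> u i.+1) -> ~~ u 0 ->
  f (Z m + \sum_(i < m) (Z i - Z i.+1) * (u i)%:R)
  = (if u m then 0 else f (Z m)) + \sum_(i < m) f (Z i.+1) * ((u i.+1)%:R - (u i)%:R).
Proof.
move=> mono u0; have notyet i : ~~ u i ->
    \sum_(l < i) (Z l - Z l.+1) * (u l)%:R = 0 /\
    \sum_(l < i) f (Z l.+1) * ((u l.+1)%:R - (u l)%:R) = 0.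
  elim: i => [|i IH] ui; first by rewrite !big_ord0.
  have ui' : ~~ u i by apply: contra ui; exact: mono.
  have [a b] := IH ui'.
  by rewrite !big_ord_recr /= a b (negbTE ui) (negbTE ui') subrr !mulr0 addr0.
elim: m => [|m IH]; first by rewrite !big_ord0 (negbTE u0) !addr0.
rewrite !big_ord_recr /=.
case: (boolP (u m)) IH => um IH.
  rewrite (mono _ um) subrr mulr0 addr0 -IH; congr f; rewrite /=; ring.
have [a b] := notyet _ um; rewrite a b mulr0 !add0r addr0.
by case: (u m.+1); rewrite /= ?subr0 ?subrr ?mulr1 ?mulr0 ?add0r ?addr0.
Qed.

Theorem adaptivity_bound lam Z (pi : policy n) : schedule k lam Z ->
  sigma_pol E p pi k <= lam * sigma_pol E p gr k.
Proof.
move=> [Z0 Z1 Zs].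
(* The schedule read backwards: [Y i] is the total weight of the times from [i] on. *)
pose Y i := Z (k - i)%N.
have Yk : Y k = 0 by rewrite /Y subnn.
have Y0 : Y 0 = 1 by rewrite /Y subn0.
have Yi i : (i < k)%N -> Y i.+1 <= Y i /\ 3 / 2 * k%:R * (Y i - Y i.+1) + pot (Y i.+1) <= lam.
  move=> ik; rewrite /Y -(subnSK ik); apply: Zs.
  by rewrite ltn_subrL /= (leq_ltn_trans _ ik).
pose g i := spread i.+1 - spread i.
pose u w X i : bool := w \in reachset X (seeds gr X i).
pose y w X : R := \sum_(i < k) (Y i - Y i.+1) * (u w X i)%:R.
have sumY : \sum_(i < k) (Y i - Y i.+1) = 1.
  rewrite -(big_mkord xpredT (fun i => Y i - Y i.+1)).
  under eq_bigr do rewrite -[_ - _]opprB.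
  by rewrite sumrN telescope_sumr // Yk Y0 sub0r opprK.
have y01 w X : 0 <= y w X <= 1.
  apply/andP; split.
    by apply: sumr_ge0 => i _; rewrite mulr_ge0 // subr_ge0; have [] := Yi i (ltn_ord i).
  rewrite -sumY; apply: ler_sum => i _; rewrite ler_piMr ?lern1 ?leq_b1 //.
  by rewrite subr_ge0; have [] := Yi i (ltn_ord i).
have one w X : 1 - y w X = \sum_(i < k) (Y i - Y i.+1) * (1 - (u w X i)%:R).
  by rewrite -[1 in LHS]sumY -sumrB; apply: eq_bigr => i _; rewrite mulrBr mulr1.
have sigE (q : policy n) : sigma_pol E p q k = \sum_w Ex (fun X => (hit q w k X)%:R).
  rewrite -Ex_sum; apply: eq_bigr => X _; congr (_ * _).
  by rewrite /sigmaL card_sumE.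
have A : sigma_pol E p pi k <=
    \sum_w Ex (fun X => pot (y w X)) + 3 / 2 * \sum_w \sum_(j < k) cost E p pi w (y w) j.
  rewrite sigE mulr_sumr -big_split; apply: ler_sum => w _; exact: hit_le.
(* If greedy first reaches [w] with its seed number [i.+1], then [y w X] equals [Y i.+1]; never
   reaching [w] contributes [pot 0 = 0]. *)
have B : \sum_w Ex (fun X => pot (y w X)) = \sum_(i < k) pot (Y i.+1) * g i.
  rewrite -Ex_sum.
  rewrite (eq_Ex _ _ (g := fun X => \sum_(i < k) pot (Y i.+1) *
    (#|reachset X (seeds gr X i.+1)|%:R - #|reachset X (seeds gr X i)|%:R))); last first.
    move=> X; rewrite (eq_bigr (fun w => \sum_(i < k) pot (Y i.+1) * ((u w X i.+1)%:R - (u w X i)%:R))).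
      rewrite exchange_big; apply: eq_bigr => i _; rewrite -mulr_sumr; congr (_ * _).
      by rewrite sumrB -!card_sumE.
    move=> w _; have := @first_time_sum (u w X) (@pot R) Y k.
    rewrite Yk add0r pot0 if_same add0r; apply.
      by move=> i; apply: (subsetP (reachset_mono (subxx _) (seeds_sub _ _ _))).
    by rewrite /u seeds0 reachset0 inE.
  by rewrite Ex_sum; apply: eq_bigr => i _; rewrite ExZ ExB.
(* For fixed [X] the pick is a fixed set in the independent world [W], so [gain_le] applies at each
   time [i]; the factor [k] counts the picks. *)
have C : \sum_w \sum_(j < k) cost E p pi w (y w) j <= k%:R * \sum_(i < k) (Y i - Y i.+1) * g i.
  rewrite exchange_big -[k in k%:R]card_ord -sum1_card natr_sum mulr_suml.
  apply: ler_sum => j _; rewrite mul1r.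
  rewrite -Ex_sum -[leRHS](ExC E p); apply: le_Ex => // X.
  have -> : \sum_w Ex (fun W => (w \in reachset W (seedsD pi X j))%:R * (1 - y w W))
     = \sum_(i < k) (Y i - Y i.+1) *
         \sum_w Ex (fun W => (w \in reachset W (seedsD pi X j))%:R * (1 - (u w W i)%:R)).
    under [RHS]eq_bigr do rewrite mulr_sumr; rewrite [RHS]exchange_big; apply: eq_bigr => w _.
    under [RHS]eq_bigr do rewrite -ExZ; rewrite -Ex_sum; apply: eq_Ex => W.
    by rewrite one mulr_sumr; apply: eq_bigr => i _; rewrite mulrCA.
  apply: ler_sum => i _; apply: ler_wpM2l.
    by rewrite subr_ge0; have [] := Yi i (ltn_ord i).
  by apply: gain_le => //; exact: seedsD_card.
have -> : sigma_pol E p gr k = \sum_(i < k) g i.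
  rewrite -(big_mkord xpredT g) telescope_sumr // spread0 subr0.
  by apply: eq_bigr => X _.
apply: (le_trans A); rewrite B [leRHS]mulr_sumr.
apply: (@le_trans _ _ (\sum_(i < k) (3 / 2 * k%:R * (Y i - Y i.+1) + pot (Y i.+1)) * g i)).
  rewrite -lerBrDl; apply: (@le_trans _ _ (3 / 2 * (k%:R * \sum_(i < k) (Y i - Y i.+1) * g i))).
    by rewrite ler_pM2l //; lra.
  rewrite -sumrB !mulr_sumr; apply: ler_sum => i _; lra.
apply: ler_sum => i _; apply: ler_wpM2r; last by have [] := Yi i (ltn_ord i).
by rewrite subr_ge0; exact: spread_mono.
Qed.
End Greedy.

(* The exponential bound and the conclusion for the optimum *)
From mathcomp Require Import classical_sets sequences exp.

(** The [k]-th power of [1 - x <= expR (- x)] at [x = 1 / (2k)]. *)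
Lemma ratio_le_expR (R : realType) k : (0 < k)%N -> ratio R k <= 1 / Num.sqrt (expR 1).
Proof.
move=> k0; have K0 : k%:R != 0 :> R by rewrite pnatr_eq0 -lt0n.
have -> : 1 / Num.sqrt (expR 1) = expR (- (2 * k%:R)^-1) ^+ k :> R.
  have e : expR 1 = expR 2^-1 ^+ 2 :> R by rewrite -expRM_natl divff // pnatr_eq0.
  have -> : (2 * k%:R)^-1 = 2^-1 / k%:R :> R by rewrite invfM.
  by rewrite -expRM_natl mulrN mulrCA divff // mulr1 expRN e sqrtr_sqr gtr0_norm ?expR_gt0 // mul1r.
have k1 : 1 <= k%:R :> R by rewrite ler1n.
have a : (2 * k%:R)^-1 <= 1 :> R by rewrite invf_le1; lra.
by apply: lerXn2r; rewrite ?nnegrE ?subr_ge0 ?(ltW (expR_gt0 _)) ?expR_ge1Dx.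
Qed.

Theorem theorem13 (R : realType) (n : nat) (E : {set ('I_n * 'I_n)})
  (p : 'I_n * 'I_n -> R)
  (hp : forall e, e \in E -> 0 <= p e <= 1)
  (k : nat) (hk : (2 <= k <= n)%N)
  (piGR : policy n) (hGR : greedy_policy E p piGR k) :
  (1 - (1 - (2 * k%:R)^-1) ^+ k) * OPT_A E p k <= sigma_pol E p piGR k /\
  (1 - 1 / Num.sqrt (expR 1)) * OPT_A E p k
    <= (1 - (1 - (2 * k%:R)^-1) ^+ k) * OPT_A E p k.
Proof.
have /andP[k2 _] := hk; have k0 : (0 < k)%N := ltnW k2.
have [Z sched] : exists Z, schedule k (1 - ratio R k)^-1 Z.
  by case: (ltnP k 12) => kk; [apply: schedule_small; rewrite k2 | exact: schedule_large].
have /andP[_ q1] := ratio_lt1 R k0.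
have sizeGR := greedy_policy_size hGR.
pose V := [set sigma_pol E p pi k | pi in [set pi : policy n | policy_size E pi k]]%classic.
(* The greedy policy makes [V] nonempty and [ub] bounds it, so that [sup] is a genuine supremum. *)
have VGR : V (sigma_pol E p piGR k) by exists piGR.
have ub : ubound V ((1 - ratio R k)^-1 * sigma_pol E p piGR k).
  by move=> _ [pi _ <-]; exact: (adaptivity_bound hp hGR pi sched).
have opt : OPT_A E p k <= (1 - ratio R k)^-1 * sigma_pol E p piGR k.
  by apply: ge_sup ub; exists (sigma_pol E p piGR k).
have opt0 : 0 <= OPT_A E p k.
  apply: (@le_trans _ _ (sigma_pol E p piGR k)).
    by apply: Ex_ge0.
  by apply: (ub_le_sup _ VGR); exists ((1 - ratio R k)^-1 * sigma_pol E p piGR k).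
split; first by rewrite -ler_pdivlMl ?subr_gt0.
by rewrite ler_wpM2r // lerD2l lerN2; exact: ratio_le_expR.
Qed.
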